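(* Let $\eta$ be any non-zero complex number. Then for every integer $k\ge 1$ $$F_{k}=\frac{1}{\eta^{k-1}}\sum_{s=0}^{\lfloor\frac{k-1}{2}\rfloor}\sum_{m=0}^{k-2s-1}\binom{k-s-m-1}{s}\binom{m+s}{m}(-1)^{m}(\eta+1)^{k-2s-m-1}(\eta^2-\eta-1)^s.$$
   Context: $\{F_k\}_{k\ge 0}$ is the Fibonacci sequence: $F_0=0$, $F_1=1$, $F_{k+1}=F_k+F_{k-1}$ for $k\ge 1$. Convention: $x^0=1$ for every $x$, including $x=0$. *)

(* Defs.v *)
From mathcomp Require Import all_boot all_order all_algebra.
From mathcomp Require Import reals complex.

Set Implicit Arguments.
Unset Strict Implicit.
Unset Printing Implicit Defensive.

Fixpoint fib (n : nat) : nat :=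
  match n with
  | 0 => 0
  | S m => match m with
           | 0 => 1
           | S l => fib m + fib l
           end
  end.

(* Main.v *)
Require Import Defs.
From mathcomp Require Import all_boot all_order all_algebra.
From mathcomp Require Import reals complex.
From mathcomp Require Import ring zify.

Import GRing.Theory.

Local Open Scope ring_scope.
Local Open Scope complex_scope.

(** The identity compares the coefficients of [x ^ (k - 1)] in two expansions
    of one rational function.  Put [u = -1], [v = eta + 1] and
    [b = eta ^ 2 - eta - 1].  Expanding a geometric series in [b x ^ 2],
      [1 / ((1 - u x) (1 - v x) - b x ^ 2)
         = \sum_s b ^ s x ^ (2 s) / ((1 - u x) (1 - v x)) ^ (s + 1)],
    and expanding each negative power by the binomial series yields the double
    sum.  On the other hand [u + v = eta] and [b - u v = eta ^ 2], so that the
    denominator is [1 - eta x - eta ^ 2 x ^ 2], and its inverse is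
    [\sum_n F_(n + 1) eta ^ n x ^ n].

    Power series are replaced here by their sequences of coefficients, and a
    product by a denominator becomes a linear recurrence.  The coefficients of
    [1 / ((1 - u x) (1 - v x)) ^ s] satisfy a recurrence of order two with
    source term the coefficients for [s - 1] ([pole_pair_rec]); summed
    against [b ^ s], the sources rebuild the sum itself, which therefore
    satisfies a homogeneous recurrence ([pole_sum_rec]).  For the values above
    it is the recurrence of [F_(n + 1) eta ^ n]. *)

Section PoleExpansion.

Variable R : comNzRingType.
Implicit Types (u v b : R) (f g : nat -> R).

Definition conv f g n : R := \sum_(0 <= i < n.+1) f i * g (n - i)%N.

Lemma conv0 f g : conv f g 0 = f 0%N * g 0%N.
Proof. by rewrite /conv big_nat1. Qed.

Lemma convC f g n : conv f g n = conv g f n.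
Proof.
rewrite /conv big_nat_rev /=; apply: eq_big_nat => i /andP[_ le_i].
by rewrite add0n subSS subKn // mulrC.
Qed.

(** If [f = f' / (1 - u x)] as power series, then
    [f g = (f' g) / (1 - u x)]. *)
Lemma conv_rec u f f' g n :
    f 0%N = f' 0%N -> (forall i, f i.+1 = u * f i + f' i.+1) ->
  conv f g n.+1 = u * conv f g n + conv f' g n.+1.
Proof.
move=> f0 fS; rewrite /conv big_nat_recl // [X in _ = _ + X]big_nat_recl // f0.
rewrite addrCA; congr (_ + _); rewrite mulr_sumr -big_split.
by apply: eq_bigr => i _; rewrite fS subSS mulrDl mulrA.
Qed.

(** The coefficient of [x ^ n] in [1 / (1 - u x) ^ s].  The predecessor is
    truncated, and for [s = 0] this correctly gives the series [1]. *)
Definition pole u s n : R := 'C((n + s).-1, n)%:R * u ^+ n.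

Lemma pole_0 u s : pole u s 0 = 1.
Proof. by rewrite /pole bin0 mul1r. Qed.

Lemma pole0S u n : pole u 0 n.+1 = 0.
Proof. by rewrite /pole addn0 bin_small ?mul0r. Qed.

Lemma pole_rec u s n : pole u s.+1 n.+1 = u * pole u s.+1 n + pole u s n.+1.
Proof.
rewrite /pole addSn addnS addSn /= binS natrD exprS; ring.
Qed.

(** The coefficient of [x ^ n] in [1 / ((1 - u x) (1 - v x)) ^ s]. *)
Definition pole_pair u v s n := conv (pole u s) (pole v s) n.

Lemma pole_pair_0 u v s : pole_pair u v s 0 = 1.
Proof. by rewrite /pole_pair conv0 !pole_0 mulr1. Qed.

Lemma pole_pair0S u v n : pole_pair u v 0 n.+1 = 0.
Proof.
rewrite /pole_pair /conv big_nat big1 // => -[|i] _; last by rewrite pole0S mul0r.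
by rewrite subn0 pole0S mulr0.
Qed.

(** The two factors are cleared one at a time; [conv (pole u s) (pole v s.+1)]
    is the intermediate series, where only [1 - u x] has been cleared. *)
Lemma pole_half_rec u v s n :
  pole_pair u v s.+1 n.+1
    = u * pole_pair u v s.+1 n + conv (pole u s) (pole v s.+1) n.+1.
Proof. by apply: conv_rec; [rewrite !pole_0 | exact: pole_rec]. Qed.

Lemma half_pole_rec u v s n :
  conv (pole u s) (pole v s.+1) n.+1
    = v * conv (pole u s) (pole v s.+1) n + pole_pair u v s n.+1.
Proof.
rewrite /pole_pair ![conv (pole u s) _ _]convC.
by apply: conv_rec; [rewrite !pole_0 | exact: pole_rec].
Qed.

Lemma pole_pair_1 u v s :
  pole_pair u v s.+1 1 = (u + v) * pole_pair u v s.+1 0 + pole_pair u v s 1.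
Proof.
rewrite pole_half_rec half_pole_rec conv0 !pole_0 pole_pair_0; ring.
Qed.

Lemma pole_pair_rec u v s n :
  pole_pair u v s.+1 n.+2
    = (u + v) * pole_pair u v s.+1 n.+1 - u * v * pole_pair u v s.+1 n
      + pole_pair u v s n.+2.
Proof.
rewrite pole_half_rec half_pole_rec.
have -> : conv (pole u s) (pole v s.+1) n.+1
    = pole_pair u v s.+1 n.+1 - u * pole_pair u v s.+1 n.
  by rewrite pole_half_rec; ring.
ring.
Qed.

(** The coefficient of [x ^ n] in
    [x ^ (2 s) / ((1 - u x) (1 - v x)) ^ (s + 1)].  Being defined for all [s],
    with value [0] once [n < 2 s], it lets the sums over [s] for different [n]
    share one range. *)
Definition layer u v s n : R :=
  if (s.*2 <= n)%N then pole_pair u v s.+1 (n - s.*2) else 0.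

Lemma layer0_rec u v n :
  layer u v 0 n.+2 = (u + v) * layer u v 0 n.+1 - u * v * layer u v 0 n.
Proof. by rewrite /layer /= !subn0 pole_pair_rec pole_pair0S addr0. Qed.

Lemma layerS_rec u v s n :
  layer u v s.+1 n.+2
    = (u + v) * layer u v s.+1 n.+1 - u * v * layer u v s.+1 n + layer u v s n.
Proof.
rewrite /layer doubleS !ltnS subSS subSS.
have [le_sn | lt_ns] := leqP s.*2 n; last first.
  by rewrite !ifN -?ltnNge; [ring | lia ..].
rewrite -(subnK le_sn); move: (n - s.*2)%N => d; rewrite addnK subSS.
(* The recurrence in degree [d] refers to the degrees [d - 1] and [d - 2]. *)
case: d => [|[|d]].
- by rewrite !ifN -?ltnNge; [rewrite !pole_pair_0; ring | lia ..].
- rewrite ifT ?ifN -?ltnNge; [| lia ..].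
  by rewrite add1n subnn pole_pair_1; ring.
- rewrite !ifT; [| lia ..].
  by rewrite !addSn !subSS -addSn !addnK pole_pair_rec.
Qed.

(** The coefficient of [x ^ n] in [1 / ((1 - u x) (1 - v x) - b x ^ 2)]. *)
Definition pole_sum u v b n : R :=
  \sum_(0 <= s < (n %/ 2).+1) layer u v s n * b ^+ s.

Lemma pole_sum_widen u v b n N : (n <= N)%N ->
  pole_sum u v b n = \sum_(0 <= s < N.+1) layer u v s n * b ^+ s.
Proof.
move=> le_nN; rewrite /pole_sum [RHS](big_cat_nat (n := (n %/ 2).+1)) //=; last by lia.
rewrite [X in _ + X]big_nat [X in _ + X]big1 ?addr0 // => s /andP[lt_ns _].
by rewrite /layer ifN ?mul0r // -ltnNge; lia.
Qed.

Lemma pole_sum_0 u v b : pole_sum u v b 0 = 1.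
Proof. by rewrite /pole_sum big_nat1 /layer pole_pair_0 mulr1. Qed.

Lemma pole_sum_1 u v b : pole_sum u v b 1 = u + v.
Proof.
by rewrite /pole_sum big_nat1 /layer pole_pair_1 pole_pair_0 pole_pair0S !mulr1 addr0.
Qed.

(** Multiplying the denominator out, it is
    [1 - (u + v) x - (b - u v) x ^ 2]. *)
Lemma pole_sum_rec u v b n :
  pole_sum u v b n.+2
    = (u + v) * pole_sum u v b n.+1 + (b - u * v) * pole_sum u v b n.
Proof.
rewrite (pole_sum_widen u v b n.+2 n.+2) // (pole_sum_widen u v b n.+1 n.+2) //.
(* One copy of the last sum is widened less: it absorbs the source terms,
   whose index is shifted by one. *)
rewrite mulrBl [in X in _ + (X - _)](pole_sum_widen u v b n n.+1) //.
rewrite (pole_sum_widen u v b n n.+2 (leqW (leqnSn n))).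
rewrite !(big_nat_recl n.+2) // layer0_rec.
under eq_bigr => s _ do rewrite layerS_rec.
have -> : \sum_(0 <= s < n.+2) ((u + v) * layer u v s.+1 n.+1
      - u * v * layer u v s.+1 n + layer u v s n) * b ^+ s.+1
    = (u + v) * (\sum_(0 <= s < n.+2) layer u v s.+1 n.+1 * b ^+ s.+1)
      - u * v * (\sum_(0 <= s < n.+2) layer u v s.+1 n * b ^+ s.+1)
      + b * (\sum_(0 <= s < n.+2) layer u v s n * b ^+ s).
  rewrite !mulr_sumr -sumrB -big_split; apply: eq_bigr => s _ /=.
  by rewrite exprS; ring.
ring.
Qed.

Lemma pole_sumE u v b n :
  pole_sum u v b n
    = \sum_(0 <= s < (n %/ 2).+1) \sum_(0 <= m < (n - 2 * s).+1)
        'C(n - s - m, s)%:R * 'C(m + s, m)%:R * u ^+ m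
          * v ^+ (n - 2 * s - m) * b ^+ s.
Proof.
apply: eq_big_nat => s /andP[_ le_s]; rewrite /layer ifT; last by lia.
rewrite /pole_pair /conv mulr_suml -mul2n; apply: eq_big_nat => m /andP[_ le_m].
rewrite /pole !addnS /= -[in X in _ * X * _](@bin_sub _ (n - 2 * s - m)); last lia.
rewrite addKn (_ : n - 2 * s - m + s = n - s - m)%N; last by lia.
ring.
Qed.

End PoleExpansion.

Arguments pole_sum {R}.

(** Both sides satisfy [a (n + 2) = eta a (n + 1) + eta ^ 2 a n]. *)
Lemma pole_sum_fib (R : comNzRingType) (eta : R) n :
  pole_sum (-1) (eta + 1) (eta ^+ 2 - eta - 1) n = (fib n.+1)%:R * eta ^+ n.
Proof.
suff [] : pole_sum (-1) (eta + 1) (eta ^+ 2 - eta - 1) n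
            = (fib n.+1)%:R * eta ^+ n
       /\ pole_sum (-1) (eta + 1) (eta ^+ 2 - eta - 1) n.+1
            = (fib n.+2)%:R * eta ^+ n.+1 by [].
elim: n => [|n [IH0 IH1]].
  by rewrite pole_sum_0 pole_sum_1 /= !mul1r; split => //; ring.
split=> //; rewrite pole_sum_rec IH0 IH1.
have -> : fib n.+3 = (fib n.+2 + fib n.+1)%N by [].
by rewrite natrD !exprS; ring.
Qed.

Theorem corollary4p7 (R : realType) (eta : R[i]) (eta_neq0 : eta <> 0)
    (k : nat) (k_ge1 : (1 <= k)%N) :
  (fib k)%:R =
    1 / eta ^+ (k - 1)%N *
    \sum_(0 <= s < ((k - 1) %/ 2).+1) \sum_(0 <= m < (k - 2 * s - 1).+1)
      'C(k - s - m - 1, s)%:R * 'C(m + s, m)%:R * (-1) ^+ m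
        * (eta + 1) ^+ (k - 2 * s - m - 1)%N
        * (eta ^+ 2 - eta - 1) ^+ s :> R[i].
Proof.
case: k k_ge1 => // n _; rewrite subn1 /=.
have eta_n0 : eta ^+ n != 0 by rewrite expf_neq0 //; apply/eqP.
rewrite [X in _ * X](_ : _ = (fib n.+1)%:R * eta ^+ n); last first.
  rewrite -pole_sum_fib pole_sumE; apply: eq_big_nat => s _.
  rewrite (_ : n.+1 - 2 * s - 1 = n - 2 * s)%N; last by lia.
  apply: eq_big_nat => m _.
  rewrite (_ : n.+1 - s - m - 1 = n - s - m)%N; last by lia.
  by rewrite (_ : n.+1 - 2 * s - m - 1 = n - 2 * s - m)%N; last by lia.
by rewrite mulrCA mul1r mulVf // mulr1.
Qed.
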